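(* Let $c=(c_1,\dots,c_k)$ be a composition (a finite tuple of positive integers) and let $\beta_i=c_1+\cdots+c_i$ for $0\le i\le k$ (so $\beta_0=0$). Then the composition polynomial of $c$ satisfies \[ g_c(q)=\sum_{i=0}^k \frac{q^{\beta_i}}{\prod_{j \neq i}(\beta_j - \beta_i)}, \] where the product runs over $j\in\{0,\dots,k\}\setminus\{i\}$.
   Context: For a composition $c=(c_1,\dots,c_k)$, the composition polynomial is \[ g_c(q) := \int_{q}^{1} \int_{q}^{t_k} \cdots \int_{q}^{t_2} t_1^{c_1-1}\cdots t_k^{c_k-1}\, dt_1\cdots dt_k . \] *)

(* Defs.v *)
From Stdlib Require Import Reals List Arith.
From Coquelicot Require Import Coquelicot.
Import ListNotations.
Open Scope R_scope.

Definition is_composition (c : list nat) : Prop :=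
  List.Forall (fun a => (0 < a)%nat) c.

(* iterated_RInt q k f x is
     int_q^x int_q^{t_k} ... int_q^{t_2} f [t_1; ...; t_k] dt_1 ... dt_k,
   with oriented integrals: the outermost variable t_k is the last entry of the
   list passed to f, and it is the upper bound of the next integral. *)
Fixpoint iterated_RInt (q : R) (k : nat) (f : list R -> R) (x : R) : R :=
  match k with
  | O => f []
  | S k' =>
      RInt (fun t => iterated_RInt q k' (fun ts => f (ts ++ [t])) t) q x
  end.

Definition Rprod (l : list R) : R := fold_right Rmult 1 l.

(* t_1^(c_1 - 1) * ... * t_k^(c_k - 1); the natural subtraction is exact on a
   composition, whose parts are positive. *)
Definition composition_monomial (c : list nat) (ts : list R) : R :=
  Rprod (map (fun at_ => snd at_ ^ (fst at_ - 1)) (combine c ts)).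

Definition composition_poly (c : list nat) (q : R) : R :=
  iterated_RInt q (length c) (composition_monomial c) 1.

Definition beta (c : list nat) (i : nat) : nat := list_sum (firstn i c).

(* Product over j in {0, ..., k} \ {i}. *)
Definition Rprod_except (k i : nat) (f : nat -> R) : R :=
  Rprod (map f (filter (fun j => negb (j =? i)%nat) (List.seq 0 (S k)))).

(* Main.v *)
Require Import Defs.
From Stdlib Require Import Reals List Arith Lia Lra.
From Coquelicot Require Import Coquelicot.
Import ListNotations.
Open Scope R_scope.

(** Replacing the upper limit [1] of the outermost integral by [x] homogenizes
    the formula: the [i]-th numerator becomes [q^beta_i * x^(beta_k - beta_i)].
    In this form it follows by induction on the number of parts. Integrating
    [t^(a-1)] times the formula for [c] from [q] to [x] gives the terms
    [i <= k] of the formula for [c ++ [a]], and the contribution of the lower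
    limit [q] is collected into the last term by the partial fraction
    decomposition of [1 / prod_j (beta_j - y)] at [y = beta_(k+1)]. *)

(** * Products over an index range, with and without an omitted index *)

Lemma Rprod_app (l l' : list R) : Rprod (l ++ l') = Rprod l * Rprod l'.
Proof.
  induction l as [|a l IH]; unfold Rprod in *; simpl; [ring|].
  rewrite IH; ring.
Qed.

Lemma Rprod_neq_0 (l : list R) : (forall x, In x l -> x <> 0) -> Rprod l <> 0.
Proof.
  induction l as [|a l IH]; intros Hl; unfold Rprod in *; simpl; [lra|].
  apply Rmult_integral_contrapositive_currified.
  - apply Hl; now left.
  - apply IH; intros x Hx; apply Hl; now right.
Qed.

Definition Rprod_upto (n : nat) (f : nat -> R) : R := Rprod (map f (seq 0 (S n))).

Lemma Rprod_upto_S (n : nat) (f : nat -> R) :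
  Rprod_upto (S n) f = Rprod_upto n f * f (S n).
Proof.
  unfold Rprod_upto.
  rewrite (seq_S (S n) 0), map_app, Rprod_app.
  unfold Rprod at 2; simpl; ring.
Qed.

Lemma Rprod_upto_neq_0 (n : nat) (f : nat -> R) :
  (forall j, (j <= n)%nat -> f j <> 0) -> Rprod_upto n f <> 0.
Proof.
  intros Hf; apply Rprod_neq_0; intros x Hx.
  apply in_map_iff in Hx; destruct Hx as [j [<- Hj]].
  apply in_seq in Hj; apply Hf; lia.
Qed.

Lemma Rprod_except_S (k i : nat) (f : nat -> R) :
  (i <= k)%nat -> Rprod_except (S k) i f = Rprod_except k i f * f (S k).
Proof.
  intros Hi; unfold Rprod_except.
  rewrite (seq_S (S k) 0), filter_app, map_app, Rprod_app; f_equal.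
  cbn [filter Nat.add].
  destruct (Nat.eqb_spec (S k) i); [lia|].
  unfold Rprod; simpl; ring.
Qed.

Lemma Rprod_except_last (k : nat) (f : nat -> R) :
  Rprod_except (S k) (S k) f = Rprod_upto k f.
Proof.
  unfold Rprod_except, Rprod_upto.
  rewrite (seq_S (S k) 0), filter_app; cbn [filter Nat.add].
  rewrite Nat.eqb_refl; cbn [negb]; rewrite app_nil_r; f_equal; f_equal.
  apply forallb_filter_id, forallb_forall; intros j Hj.
  apply in_seq in Hj; destruct (Nat.eqb_spec j (S k)); [lia|reflexivity].
Qed.

Lemma Rprod_except_neq_0 (k i : nat) (f : nat -> R) :
  (forall j, (j <= k)%nat -> j <> i -> f j <> 0) -> Rprod_except k i f <> 0.
Proof.
  intros Hf; apply Rprod_neq_0; intros x Hx.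
  apply in_map_iff in Hx; destruct Hx as [j [<- Hj]].
  apply filter_In in Hj; destruct Hj as [Hj Hji]; apply in_seq in Hj.
  apply Hf; [lia|]; intros ->; now rewrite Nat.eqb_refl in Hji.
Qed.

Lemma Rprod_except_ext (k i : nat) (f g : nat -> R) :
  (forall j, (j <= k)%nat -> f j = g j) -> Rprod_except k i f = Rprod_except k i g.
Proof.
  intros Hfg; unfold Rprod_except; f_equal; apply map_ext_in.
  intros j Hj; apply filter_In in Hj; destruct Hj as [Hj _].
  apply in_seq in Hj; apply Hfg; lia.
Qed.

(** Induction on [n] with [y] general, because the hypothesis is used at two points. Its value at
    [y = x (S n)] cancels the last term of the sum, and its value at [y] gives the right-hand
    side. *)
Lemma partial_fractions (x : nat -> R) (n : nat) (y : R) :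
  (forall i j, (i <= n)%nat -> (j <= n)%nat -> i <> j -> x i <> x j) ->
  (forall i, (i <= n)%nat -> x i <> y) ->
  sum_f_R0 (fun i => / (Rprod_except n i (fun j => x j - x i) * (y - x i))) n
  = - / Rprod_upto n (fun j => x j - y).
Proof.
  revert y; induction n as [|n IH]; intros y Hx Hy.
  - assert (H0 := Hy 0%nat (le_n _)).
    unfold Rprod_except, Rprod_upto, Rprod; simpl; field; lra.
  - assert (Hyn := Hy (S n) (le_n _)).
    rewrite tech5, Rprod_except_last, Rprod_upto_S.
    (* With [s = x (S n)], the identity is [1/((s - x_i)(y - x_i)) = (1/(s - x_i) - 1/(y - x_i)) /
       (y - s)]. *)
    rewrite (sum_eq _ (fun i =>
      (/ (Rprod_except n i (fun j => x j - x i) * (x (S n) - x i))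
       - / (Rprod_except n i (fun j => x j - x i) * (y - x i)))
      * / (y - x (S n)))).
    + rewrite <- scal_sum, minus_sum, !IH.
      * assert (Rprod_upto n (fun j => x j - x (S n)) <> 0).
        { apply Rprod_upto_neq_0; intros j Hj; apply Rminus_eq_contra, Hx; lia. }
        assert (Rprod_upto n (fun j => x j - y) <> 0).
        { apply Rprod_upto_neq_0; intros j Hj; apply Rminus_eq_contra, Hy; lia. }
        field; repeat split; try assumption; lra.
      * intros i j ? ?; apply Hx; lia.
      * intros i ?; apply Hy; lia.
      * intros i j ? ?; apply Hx; lia.
      * intros i ?; apply Hx; lia.
    + intros i Hi.
      rewrite (Rprod_except_S n i) by assumption.
      assert (Rprod_except n i (fun j => x j - x i) <> 0).
      { apply Rprod_except_neq_0; intros j ? ?; apply Rminus_eq_contra, Hx; lia. }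
      assert (x i <> y) by (apply Hy; lia).
      assert (x i <> x (S n)) by (apply Hx; lia).
      field; repeat split; try assumption; lra.
Qed.

(** * Integrals of sums of powers *)

Lemma is_RInt_pow_S (a b : R) (n : nat) :
  is_RInt (fun t => t ^ n) a b ((b ^ S n - a ^ S n) / INR (S n)).
Proof.
  assert (Hn : INR (S n) <> 0) by (apply not_0_INR; lia).
  replace ((b ^ S n - a ^ S n) / INR (S n))
    with (b ^ S n / INR (S n) - a ^ S n / INR (S n))
    by (field; assumption).
  apply (is_RInt_derive (fun t => t ^ S n / INR (S n))).
  - intros t _; auto_derive; [trivial|].
    cbn [Nat.pred]; field; assumption.
  - intros t _; apply (ex_derive_continuous (fun u => u ^ n)); auto_derive; trivial.
Qed.

Lemma is_RInt_sum_pow (A : nat -> R) (e : nat -> nat) (n : nat) (a b : R) :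
  is_RInt (fun t => sum_f_R0 (fun i => A i * t ^ e i) n) a b
    (sum_f_R0 (fun i => A i * ((b ^ S (e i) - a ^ S (e i)) / INR (S (e i)))) n).
Proof.
  induction n as [|n IH]; cbn [sum_f_R0].
  - apply (is_RInt_scal (fun t => t ^ e 0%nat)), is_RInt_pow_S.
  - apply (is_RInt_plus (fun t => sum_f_R0 (fun i => A i * t ^ e i) n));
      [exact IH|].
    apply (is_RInt_scal (fun t => t ^ e (S n))), is_RInt_pow_S.
Qed.

(** * Partial sums of a composition *)

Lemma beta_strict_mono (c : list nat) (i j : nat) :
  is_composition c -> (i < j <= length c)%nat -> (beta c i < beta c j)%nat.
Proof.
  intros Hc; revert i j; induction Hc as [|a c Ha Hc IH]; intros i j Hij;
    simpl in Hij; [lia|].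
  destruct j as [|j]; [lia|].
  destruct i as [|i]; unfold beta in *; simpl; [lia|].
  assert (H := IH i j ltac:(lia)); lia.
Qed.

(** Makes the denominators nonzero and the nodes of the partial fraction decomposition distinct. *)
Lemma beta_neq (c : list nat) (i j : nat) :
  is_composition c -> (i <= length c)%nat -> (j <= length c)%nat -> i <> j ->
  INR (beta c i) <> INR (beta c j).
Proof.
  intros Hc Hi Hj Hij H; apply INR_eq in H.
  destruct (Nat.lt_ge_cases i j).
  - assert (H1 := beta_strict_mono c i j Hc ltac:(lia)); lia.
  - assert (H1 := beta_strict_mono c j i Hc ltac:(lia)); lia.
Qed.

Lemma beta_le_last (c : list nat) (i : nat) :
  is_composition c -> (i <= length c)%nat -> (beta c i <= beta c (length c))%nat.
Proof.
  intros Hc Hi; destruct (Nat.eq_dec i (length c)) as [->|]; [lia|].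
  apply Nat.lt_le_incl, beta_strict_mono; [assumption|lia].
Qed.

Lemma beta_snoc (c : list nat) (a i : nat) :
  (i <= length c)%nat -> beta (c ++ [a]) i = beta c i.
Proof.
  intros Hi; unfold beta; rewrite firstn_app.
  replace (i - length c)%nat with 0%nat by lia.
  now rewrite firstn_O, app_nil_r.
Qed.

Lemma beta_snoc_last (c : list nat) (a : nat) :
  beta (c ++ [a]) (S (length c)) = (beta c (length c) + a)%nat.
Proof.
  unfold beta; rewrite firstn_all.
  rewrite firstn_all2 by (rewrite length_app; simpl; lia).
  rewrite list_sum_app; simpl; lia.
Qed.

(** * The integrand and the homogenized formula when a part is appended *)

Lemma composition_monomial_snoc (c : list nat) (a : nat) (ts : list R) (t : R) :
  length ts = length c ->
  composition_monomial (c ++ [a]) (ts ++ [t])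
  = composition_monomial c ts * t ^ (a - 1).
Proof.
  revert ts; induction c as [|b c IH]; intros [|s ts] Hts; simpl in Hts; try lia.
  - unfold composition_monomial, Rprod; simpl; ring.
  - injection Hts as Hts; specialize (IH ts Hts).
    unfold composition_monomial, Rprod in *; simpl; rewrite IH; ring.
Qed.

(** Homogeneous of degree [beta_k] in [q] and [x]. On a composition the natural subtraction in the
    exponent is exact, since [beta_i <= beta_k]. *)
Definition homogeneous_formula (c : list nat) (q x : R) : R :=
  sum_f_R0 (fun i =>
    q ^ beta c i
    / Rprod_except (length c) i (fun j => INR (beta c j) - INR (beta c i))
    * x ^ (beta c (length c) - beta c i)) (length c).

Lemma is_RInt_homogeneous_formula (c : list nat) (a : nat) (q x : R) :
  is_composition (c ++ [a]) ->
  is_RInt (fun t => t ^ (a - 1) * homogeneous_formula c q t) q x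
    (homogeneous_formula (c ++ [a]) q x).
Proof.
  intros Hca.
  assert (Hc : is_composition c /\ (0 < a)%nat).
  { apply Forall_app in Hca; destruct Hca as [Hc Ha].
    split; [exact Hc|]; now inversion Ha. }
  destruct Hc as [Hc Ha].
  set (k := length c).
  set (b := beta (c ++ [a])).
  set (P := fun i => Rprod_except k i (fun j => INR (b j) - INR (b i))).
  assert (Hk : length (c ++ [a]) = S k) by (rewrite length_app; simpl; lia).
  assert (Hb : forall i j, (i <= S k)%nat -> (j <= S k)%nat -> i <> j ->
    INR (b i) <> INR (b j)) by (intros; apply beta_neq; rewrite ?Hk; assumption).
  assert (Hbk : forall i, (i <= k)%nat -> (b i < b (S k))%nat).
  { intros i Hi; apply beta_strict_mono; [assumption|lia]. }
  assert (HP : forall i, (i <= k)%nat -> P i <> 0).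
  { intros i Hi; apply Rprod_except_neq_0; intros j ? ?.
    apply Rminus_eq_contra, Hb; lia. }
  set (A := fun i => q ^ b i / P i).
  (* The exponent of [t] in [t^(a-1) * t^(beta_k - beta_i)]. Its successor [beta_(k+1) - beta_i] is
     the divisor produced by integration, which is the new factor [j = k+1] of the [i]-th
     denominator. *)
  set (e := fun i => (b (S k) - b i - 1)%nat).
  apply (is_RInt_ext (fun t => sum_f_R0 (fun i => A i * t ^ e i) k)).
  { intros t _; unfold homogeneous_formula; fold k.
    rewrite scal_sum; apply sum_eq; intros i Hi.
    unfold A, e, P, b.
    rewrite (beta_snoc c a i Hi), beta_snoc_last; fold k.
    rewrite (Rprod_except_ext k i _ (fun j => INR (beta c j) - INR (beta c i)))
      by (intros j Hj; now rewrite beta_snoc).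
    rewrite Rmult_assoc, <- pow_add; do 2 f_equal.
    assert (H := beta_le_last c i Hc Hi); fold k in H; lia. }
  replace (homogeneous_formula (c ++ [a]) q x)
    with (sum_f_R0 (fun i => A i * ((x ^ S (e i) - q ^ S (e i)) / INR (S (e i)))) k);
    [apply is_RInt_sum_pow|].
  unfold homogeneous_formula; rewrite Hk, tech5, Rprod_except_last.
  fold b; rewrite Nat.sub_diag, pow_O, Rmult_1_r.
  assert (Hpf := partial_fractions (fun i => INR (b i)) k (INR (b (S k)))).
  (* The coefficient of the last term becomes minus the sum of the other coefficients, so the claim
     can be compared term by term in [i <= k]. *)
  assert (HQ : / Rprod_upto k (fun j => INR (b j) - INR (b (S k)))
    = - sum_f_R0 (fun i => / (P i * (INR (b (S k)) - INR (b i)))) k).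
  { unfold P; rewrite Hpf; [ring| |]; intros; apply Hb; lia. }
  unfold Rdiv; rewrite HQ.
  rewrite Ropp_mult_distr_r_reverse, scal_sum.
  match goal with |- _ = ?u + - ?v => change (u + - v) with (u - v) end.
  rewrite <- minus_sum; apply sum_eq; intros i Hi.
  rewrite Rprod_except_S by assumption; fold (P i).
  assert (Hbi := Hbk i Hi); assert (HPi := HP i Hi).
  assert (He : S (e i) = (b (S k) - b i)%nat) by (unfold e; lia).
  assert (Hd : INR (b (S k)) - INR (b i) <> 0)
    by (apply Rminus_eq_contra, Hb; lia).
  rewrite He, minus_INR by lia.
  (* The second factor is the power of [q] that the lower limit contributes to the [i]-th term. *)
  replace (q ^ b (S k)) with (q ^ b i * q ^ (b (S k) - b i))
    by (rewrite <- pow_add; f_equal; lia).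
  unfold A; field; split; assumption.
Qed.

(* The scalar [m] absorbs the powers of the outer variables, which are constants
   for the inner integrals. *)
Lemma iterated_RInt_scal_monomial (c : list nat) (q : R) :
  is_composition c -> forall (m x : R) (f : list R -> R),
  (forall ts, length ts = length c -> f ts = m * composition_monomial c ts) ->
  iterated_RInt q (length c) f x = m * homogeneous_formula c q x.
Proof.
  (* Induction from the right: the last part belongs to the outermost variable. *)
  induction c as [|a c IH] using rev_ind; intros Hca m x f Hf.
  - simpl; rewrite Hf by reflexivity.
    unfold homogeneous_formula, composition_monomial, Rprod_except, Rprod; simpl.
    field.
  - assert (Hc : is_composition c) by (apply Forall_app in Hca; apply Hca).
    assert (Hk : length (c ++ [a]) = S (length c))
      by (rewrite length_app; simpl; lia).
    rewrite Hk in *; cbn [iterated_RInt].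
    apply is_RInt_unique.
    apply (is_RInt_ext (fun t => m * (t ^ (a - 1) * homogeneous_formula c q t))).
    (* The outer variable [t] is both the upper limit of the inner integral and, through [t^(a-1)],
       part of its scalar. *)
    + intros t _; rewrite (IH Hc (m * t ^ (a - 1))); [apply eq_sym, Rmult_assoc|].
      intros ts Hts; rewrite Hf by (rewrite length_app; simpl; lia).
      rewrite composition_monomial_snoc by assumption; ring.
    + apply (is_RInt_scal (fun t => t ^ (a - 1) * homogeneous_formula c q t)).
      now apply is_RInt_homogeneous_formula.
Qed.

Theorem theorem6p3 (c : list nat) (hc : is_composition c) (q : R) :
  composition_poly c q =
  sum_f_R0 (fun i =>
    q ^ (beta c i) /
    Rprod_except (length c) i (fun j => INR (beta c j) - INR (beta c i)))
    (length c).
Proof.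
  unfold composition_poly.
  rewrite (iterated_RInt_scal_monomial c q hc 1) by (intros; ring).
  unfold homogeneous_formula; rewrite Rmult_1_l.
  (* The outermost upper limit is [x = 1], so the homogenizing powers of [x] disappear. *)
  apply sum_eq; intros i _; rewrite pow1; ring.
Qed.
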